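(* Let $p$ be a Sophie Germain prime with $p\equiv 3 \pmod 4$, and let $k\geq 0$ be an integer. Then the only non-negative integer solutions of the equation $p^x-(2^{k}(2p+1))^y=z^2$ are $(x,y,z)=(0,0,0)$ (for any $p,k$) and $(p,k,x,y,z)=(3,3,4,1,5)$.
   Context: A prime $p$ is called a Sophie Germain prime if $2p+1$ is also prime. *)

(* Defs.v *)
From mathcomp Require Import all_boot.

Definition sophie_germain_prime (p : nat) : bool :=
  prime p && prime (2 * p + 1).

(* Main.v *)
(* Put q = 2p + 1, so q = 1 mod p and q = 7 mod 8.  For x > 0, reduction modulo
   p makes -2^(ky) a square, so ky is odd because -1 is not a square mod p.
   Modulo q, 2 is a square and 2p = -1, so p is not a square and x = 2m is even.
   The factors p^m - z and p^m + z are twice coprime numbers, whence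
   p^m = 1 + 2^n q^y or p^m = q^y + 2^n with n = ky - 2; modulo q, m is even.
   The first equation factors once more and fails modulo p and modulo 8; the
   second one forces n = 1 modulo 8, then p = 3 modulo p. *)
Require Import Defs.
From mathcomp Require Import all_boot all_order all_algebra finfield zify.

Set Implicit Arguments.
Unset Strict Implicit.
Unset Printing Implicit Defensive.

Import GRing.Theory Num.Theory.
Local Open Scope ring_scope.

(** * Fermat's little theorem and sums of two squares modulo p *)

Lemma natr_Fp_eq0 (p n : nat) : prime p -> (n%:R == 0 :> 'F_p) = (p %| n)%N.
Proof. by move=> p_pr; rewrite (dvdn_pcharf (pchar_Fp p_pr)). Qed.

Lemma expf_pred_Fp (p : nat) (a : 'F_p) : prime p -> a != 0 -> a ^+ p.-1 = 1.
Proof.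
move=> p_pr a0; apply: (mulfI a0).
by rewrite -exprS prednK ?prime_gt0 // mulr1 -{2}(expf_card a) card_Fp.
Qed.

Lemma oneN1_Fp (p : nat) : prime p -> odd p -> (1 : 'F_p) != -1.
Proof.
move=> p_pr p_odd; rewrite -subr_eq0 opprK (natr_Fp_eq0 2 p_pr).
by apply/negP=> /(dvdn_leq (isT : 0 < 2)%N); have := prime_gt1 p_pr; lia.
Qed.

(** Otherwise [a ^ 2 = - b ^ 2] modulo p with both sides nonzero; raising to the power (p - 1) / 2,
    which is odd, gives 1 = -1 by Fermat. *)
Lemma dvdn_sqrD (p a b : nat) : prime p -> (p = 3 %[mod 4])%N ->
  (p %| a ^ 2 + b ^ 2)%N -> (p %| b)%N.
Proof.
move=> p_pr p3; rewrite -!natr_Fp_eq0 // natrD !natrX addr_eq0 => /eqP ab.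
apply: contraT => b0.
have a0 : (a%:R : 'F_p) != 0.
  by rewrite -sqrf_eq0 ab oppr_eq0 sqrf_eq0.
have p1 : p.-1 = (2 * (p %/ 4).*2.+1)%N by lia.
have := expf_pred_Fp p_pr a0; rewrite p1 exprM ab exprNn -exprM -p1.
rewrite expf_pred_Fp // mulr1 -signr_odd /= odd_double /= expr1 => /esym/eqP.
by rewrite (negPf (oneN1_Fp _ _)) //; lia.
Qed.

(** * Quadratic characters of 2 and p modulo 2p + 1 *)

Lemma prod_even_odd (h : nat) :
  (\prod_(i < h) (2 * i.+1) * \prod_(i < h.+1) (2 * i).+1 = (2 * h).+1`!)%N.
Proof.
elim: h => [|h IHh]; first by rewrite big_ord0 big_ord_recl big_ord0.
rewrite big_ord_recr [X in (_ * X)%N]big_ord_recr /= mulnACA IHh.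
have ->: ((2 * h.+1).+1 = (2 * h).+3)%N by lia.
by rewrite !factS; nia.
Qed.

(* Gauss: in 2 * 4 * ... * (4h+2) the h + 1 factors exceeding 2h + 1 are
   replaced by minus their complement to 4h + 3, which is odd; h + 1 is even. *)
Lemma two_expf_Fp (h q : nat) : prime q -> q = (4 * h + 3)%N -> odd h ->
  (2 : 'F_q) ^+ (2 * h).+1 = 1.
Proof.
move=> q_pr qE h_odd.
have f0 : ((2 * h).+1`!%:R : 'F_q) != 0.
  rewrite natr_Fp_eq0 //; have: ((2 * h).+1 < q)%N by lia.
  elim: (2 * h).+1 => [|m IHm] mq; first by rewrite Euclid_dvd1.
  by rewrite factS Euclid_dvdM // negb_or IHm ?gtnNdvd //; lia.
apply: (mulIf f0); rewrite mul1r.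
have ->: (2 : 'F_q) ^+ (2 * h).+1 * (2 * h).+1`!%:R
    = \prod_(i < h + h.+1) (2 * i.+1)%:R.
  under eq_bigr do rewrite natrM.
  rewrite big_split /= prodr_const card_ord; congr (_ ^+ _ * _); first lia.
  rewrite fact_prod big_add1 big_mkord natr_prod.
  by have ->: (2 * h).+1 = (h + h.+1)%N by lia.
rewrite big_split_ord /= -prod_even_odd natrM !natr_prod; congr (_ * _).
rewrite (reindex_inj rev_ord_inj) /=.
rewrite (eq_bigr (fun i : 'I_h.+1 => - (2 * i).+1%:R)) => [|i _].
  by rewrite prodrN card_ord -signr_odd /= h_odd mul1r.
apply/eqP; rewrite -subr_eq0 opprK -natrD natr_Fp_eq0 //.
suff ->: (2 * (h + (h.+1 - i.+1)).+1 + (2 * i).+1 = q)%N by [].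
by have := ltn_ord i; lia.
Qed.

(** For q = 2p + 1 the exponent p is (q - 1) / 2, so 2 is a square modulo q. Here q = 4h + 3 with h
    = (p - 1) / 2 odd. *)
Lemma two_expf_SG (p : nat) : prime (2 * p + 1) -> (p = 3 %[mod 4])%N ->
  (2 : 'F_(2 * p + 1)) ^+ p = 1.
Proof.
move=> q_pr p3; have pE : (2 * p./2).+1 = p by lia.
by rewrite -[X in _ ^+ X]pE two_expf_Fp //; lia.
Qed.

(** Modulo 2p + 1 the product 2p is -1 and 2 has character 1, so p has character (-1)^p = -1. *)
Lemma self_expf_SG (p : nat) : prime (2 * p + 1) -> (p = 3 %[mod 4])%N ->
  (p%:R : 'F_(2 * p + 1)) ^+ p = -1.
Proof.
move=> q_pr p3.
have e : (2 : 'F_(2 * p + 1)) * p%:R = -1.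
  by apply/eqP; rewrite -subr_eq0 opprK -natrM natr1 natr_Fp_eq0 // addn1 dvdnn.
have := congr1 (fun a => a ^+ p) e; rewrite exprMn two_expf_SG // mul1r => ->.
by rewrite -signr_odd; have ->: odd p by lia.
Qed.

(** By Euler's criterion [a] is a nonzero square, whereas an odd power of p has character -1. *)
Lemma even_exp_SG (p m : nat) (a : 'F_(2 * p + 1)) :
  prime (2 * p + 1) -> (p = 3 %[mod 4])%N ->
  p%:R ^+ m = a -> a ^+ p = 1 -> ~~ odd m.
Proof.
move=> q_pr p3 <-; rewrite exprAC self_expf_SG // -signr_odd; case: odd => //.
by move/esym/eqP; rewrite (negPf (oneN1_Fp _ _)) //; lia.
Qed.

(** * Reduction modulo p *)

Lemma safe_prime_Fp_eq1 (p y : nat) :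
  prime p -> ((2 * p + 1) ^ y)%:R = 1 :> 'F_p.
Proof.
by move=> p_pr; rewrite natrX natrD natrM pchar_Fp_0 // mulr0 add0r expr1n.
Qed.

Lemma self_expf_Fp_eq0 (p m : nat) : prime p -> (p%:R : 'F_p) ^+ m.+1 = 0.
Proof. by move=> p_pr; rewrite pchar_Fp_0 // expr0n. Qed.

(** As 2p + 1 = 1 modulo p, an even n would make p divide the sum of squares z^2 + (2^(n/2))^2,
    hence a power of 2. *)
Lemma odd_two_exp_SG (p x n y z : nat) :
  prime p -> (p = 3 %[mod 4])%N -> (0 < x)%N ->
  (p ^ x = 2 ^ n * (2 * p + 1) ^ y + z ^ 2)%N -> odd n.
Proof.
move=> p_pr p3; case: x => // x _ /(congr1 (fun n => n%:R : 'F_p)).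
rewrite natrX self_expf_Fp_eq0 // natrD natrM safe_prime_Fp_eq1 //.
rewrite mulr1 -natrD => /esym/eqP; rewrite natr_Fp_eq0 // addnC;
  apply: contraTT => n_even.
rewrite -(even_halfK n_even) -muln2 expnM; apply/negP => /(dvdn_sqrD p_pr p3).
by rewrite Euclid_dvdX // => /andP[/(dvdn_leq (isT : 0 < 2)%N)]; lia.
Qed.

(** * Factoring p^(2m) - z^2 *)

Lemma coprime_split_two_exp (a b n q y : nat) : prime q -> odd a -> coprime a b ->
  (a * b = 2 ^ n * q ^ y)%N ->
  (a = 1 /\ b = 2 ^ n * q ^ y \/ a = q ^ y /\ b = 2 ^ n)%N.
Proof.
move=> q_pr a_odd ab abE.
have a2 : coprime a (2 ^ n) by rewrite coprimeXr // coprimen2.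
have a_dv : (a %| q ^ y)%N by rewrite -(Gauss_dvdr _ a2) -abE dvdn_mulr.
have a0 := odd_gt0 a_odd.
have qy0 : (0 < q ^ y)%N by rewrite expn_gt0 prime_gt0.
(* Being odd, [a] divides [q ^ y]. By coprimality either q misses [a], so [a] is 1, or q misses [b],
   so [a] takes all of [q ^ y]. *)
have [qa|qa] := boolP (q %| a)%N; last first.
  have: coprime a (q ^ y) by rewrite coprimeXr // coprime_sym prime_coprime.
  rewrite /coprime (gcdn_idPl a_dv) => /eqP a1; left; split=> //.
  by rewrite -abE a1 mul1n.
have aE : a = (q ^ y)%N.
  apply/eqP; rewrite eqn_dvd a_dv -(@Gauss_dvdl _ _ b) ?abE ?dvdn_mull //.
  by rewrite coprimeXl // (coprime_dvdl qa).
right; split=> //; apply/eqP; rewrite -(eqn_pmul2l a0) abE.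
by rewrite [in X in _ == X]aE mulnC.
Qed.

Lemma sqr_odd_mod8 (a : nat) : odd a -> (a ^ 2 = 1 %[mod 8])%N.
Proof.
move=> a_odd; rewrite -modnXm.
have : [|| a %% 8 == 1, a %% 8 == 3, a %% 8 == 5 | a %% 8 == 7]%N by lia.
by case/or4P=> /eqP->.
Qed.

Lemma expn_odd_mod8 (q y : nat) :
  (q = 7 %[mod 8])%N -> odd y -> (q ^ y = 7 %[mod 8])%N.
Proof.
move=> q7 y_odd; rewrite -(odd_double_half y) y_odd expnS -muln2 expnM.
by rewrite -modnMmr sqr_odd_mod8 ?oddX ?modnMmr ?muln1 //; lia.
Qed.

Lemma split_even_power (p q m n y z : nat) :
  prime p -> odd p -> prime q -> odd q -> p != q -> (0 < n)%N ->
  (p ^ m.*2 = 2 ^ n * q ^ y + z ^ 2)%N ->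
  exists2 n', n = n'.+2 &
    (p ^ m = 1 + 2 ^ n' * q ^ y \/ p ^ m = q ^ y + 2 ^ n')%N.
Proof.
move=> p_pr p_odd q_pr q_odd pq n0.
rewrite -muln2 expnM => E.
have P_odd : odd (p ^ m) by rewrite oddX p_odd orbT.
have qy_odd : odd (q ^ y) by rewrite oddX q_odd orbT.
have z_odd : odd z.
  have := congr1 odd E; rewrite oddD oddM !oddX p_odd q_odd !orbT /=.
  by case: n n0 {E}.
have T0 : (0 < 2 ^ n * q ^ y)%N by rewrite muln_gt0 !expn_gt0 (prime_gt0 q_pr).
have zP : (z < p ^ m)%N by rewrite -ltn_sqr; lia.
(* Since z is odd, [a] and [b] are exactly (p^m - z) / 2 and (p^m + z) / 2. *)
set a := (p ^ m - z)./2; set b := (a + z)%N.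
have abP : (a + b = p ^ m)%N by lia.
have abE : (4 * (a * b) = 2 ^ n * q ^ y)%N.
  have [aE bE] : (p ^ m = 2 * a + z /\ b = a + z)%N by lia.
  by move: E; rewrite aE bE; nia.
(* As [q ^ y] is odd, the factor 4 in [abE] forces n to be at least 2. *)
case: n => [|[|n]] // in n0 E T0 abE *.
  have : odd (q ^ y) by []; move: abE; rewrite expn1; lia.
exists n => //.
have {}abE : (a * b = 2 ^ n * q ^ y)%N.
  by move: abE; rewrite !expnS; lia.
(* A common divisor of [a] and [b] divides p^m, while the only primes that can divide ab are 2 and
   q. *)
have ab_cop : coprime a b.
  have: coprime (p ^ m) (a * b).
    rewrite abE coprimeXl // coprimeMr !coprimeXr //.
      by rewrite prime_coprime // dvdn_prime2.
    by rewrite coprimen2.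
  by rewrite coprimeMr -abP coprime_sym /coprime gcdnDl => /andP[].
have: odd a || odd b by lia.
case/orP=> odd_ab.
  by have [[a1 b1]|[a1 b1]] := coprime_split_two_exp q_pr odd_ab ab_cop abE;
    [left|right]; rewrite -abP a1 b1.
rewrite coprime_sym in ab_cop; rewrite mulnC in abE.
by have [[a1 b1]|[a1 b1]] := coprime_split_two_exp q_pr odd_ab ab_cop abE;
  [left|right]; rewrite -abP addnC a1 b1.
Qed.

(** * The equations p^m = 1 + 2^n q^y and p^m = q^y + 2^n *)

Lemma dvdn_three_prime (p : nat) : prime p -> (p %| 3)%N -> p = 3%N.
Proof. by move=> p_pr; rewrite dvdn_prime2 // => /eqP. Qed.

(** Rules out 3^s = 2^j - 1 with j at least 3, the right side being 7 modulo 8. *)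
Lemma expn3_mod8 (s : nat) : (3 ^ s %% 8 < 4)%N.
Proof.
rewrite -(odd_double_half s) expnD -muln2 mulnC expnM -modnMml.
by rewrite sqr_odd_mod8 ?oddX ?orbT //; case: odd.
Qed.

(** With p^s = 2c + 1 the equality would give 4c(c + 1) = 2^n q^y, and the consecutive factors c and
    c + 1 are coprime, so the odd one is 1 or q^y. *)
Lemma even_power_neq1D (p s n y : nat) :
  prime p -> prime (2 * p + 1) -> (p = 3 %[mod 4])%N -> (0 < y)%N ->
  (p ^ s.*2 <> 1 + 2 ^ n * (2 * p + 1) ^ y)%N.
Proof.
move=> p_pr q_pr p3 y0; set q := (2 * p + 1)%N in q_pr *.
rewrite -muln2 expnM => E.
have p_odd : odd p by lia.
have P_odd : odd (p ^ s) by rewrite oddX p_odd orbT.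
have q_odd : odd q by lia.
have qy_odd : odd (q ^ y) by rewrite oddX q_odd orbT.
have qy_ge : (7 <= q ^ y)%N.
  by apply: leq_trans (leq_pexp2l (prime_gt0 q_pr) y0); rewrite expn1; lia.
have s0 : (0 < s)%N.
  by case: s E {P_odd} => // E; have := expn_gt0 2 n; nia.
have P0 : ((p ^ s)%:R : 'F_p) = 0.
  by rewrite natrX -(prednK s0) self_expf_Fp_eq0.
set c := (p ^ s)./2; have cE : (p ^ s = 2 * c + 1)%N by lia.
have {}E : (2 ^ n * q ^ y = 4 * (c * c.+1))%N by move: E; rewrite cE; nia.
case: n => [|[|n]] in E; [lia|lia|].
have {}E : (c * c.+1 = 2 ^ n * q ^ y)%N by move: E; rewrite !expnS; lia.
have [c_odd|c_even] := boolP (odd c).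
  have [[c1 E1]|[c1 E1]] := coprime_split_two_exp q_pr c_odd (coprimenS c) E.
    by have := expn_gt0 2 n; nia.
  (* Here p^s = 2q^y + 1 is 3 modulo p, so p = 3; but p^s = 2^(n+1) - 1 is also 7 modulo 8. *)
  have p3E : p = 3%N.
    apply: dvdn_three_prime => //; rewrite -natr_Fp_eq0 //.
    by move/eqP: P0; rewrite cE c1 natrD natrM safe_prime_Fp_eq1 // mulr1 natr1.
  case: n => [|[|[|n]]] in E E1; [lia|lia|lia|].
  have := expn3_mod8 s; rewrite -{1}p3E cE.
  by move: E1; rewrite !expnS; lia.
have c1_odd : odd c.+1 by [].
rewrite mulnC in E.
have [[c1 E1]|[c1 E1]] := coprime_split_two_exp q_pr c1_odd (coprimeSn c) E.
  by have := expn_gt0 2 n; nia.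
(* Here p^s + 1 = 2q^y, which reads 1 = 2 modulo p. *)
have : ((p ^ s + 1)%:R : 'F_p) = (q ^ y + q ^ y)%:R by congr _%:R; lia.
rewrite !natrD P0 safe_prime_Fp_eq1 // => /addIr/esym/eqP.
by rewrite oner_eq0.
Qed.

(** Modulo 2p + 1 the power p^m equals 2^n, a square, so m is even. Modulo 8 this gives 1 = 7 + 2^n,
    hence n = 1; then modulo p, 0 = 1 + 2. *)
Lemma power_eqDtwo_exp (p m n y : nat) :
  prime p -> prime (2 * p + 1) -> (p = 3 %[mod 4])%N -> odd y -> odd n ->
  (p ^ m = (2 * p + 1) ^ y + 2 ^ n)%N -> n = 1%N /\ p = 3%N.
Proof.
move=> p_pr q_pr p3 y_odd n_odd E; have y0 := odd_gt0 y_odd.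
have m_even : ~~ odd m.
  apply: (@even_exp_SG p m (2 ^+ n)) => //.
    have := congr1 (fun i => i%:R : 'F_(2 * p + 1)) E.
    rewrite natrD natrX => ->; rewrite !natrX -(prednK y0) self_expf_Fp_eq0 //.
    by rewrite add0r.
  by rewrite exprAC two_expf_SG // expr1n.
have p_odd : odd p by lia.
have P1 : (p ^ m = 1 %[mod 8])%N.
  rewrite -(even_halfK m_even) -muln2 expnM sqr_odd_mod8 //.
  by rewrite oddX p_odd orbT.
have q7 : ((2 * p + 1) ^ y = 7 %[mod 8])%N by apply: expn_odd_mod8 => //; lia.
case: n => [|[|[|n]]] // in n_odd E *.
  split=> //; apply: dvdn_three_prime => //; rewrite -natr_Fp_eq0 //.
  have m0 : (0 < m)%N by case: m E {m_even P1} => //; lia.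
  have := congr1 (fun i => i%:R : 'F_p) E.
  rewrite natrX -(prednK m0) self_expf_Fp_eq0 // natrD safe_prime_Fp_eq1 //.
  by rewrite nat1r => <-.
by move: E; rewrite !expnS; lia.
Qed.

(** * Solving the equation over the naturals, then over the integers *)

Lemma SG_equation_nat (p k x y z : nat) :
  prime p -> prime (2 * p + 1) -> (p = 3 %[mod 4])%N -> (0 < x)%N ->
  (p ^ x = (2 ^ k * (2 * p + 1)) ^ y + z ^ 2)%N ->
  [/\ p = 3, k = 3, x = 4, y = 1 & z = 5]%N.
Proof.
move=> p_pr q_pr p3 x0; rewrite expnMn -expnM => E.
have ky_odd := odd_two_exp_SG p_pr p3 x0 E.
have /andP[k_odd y_odd] : odd k && odd y by rewrite -oddM.
have y0 := odd_gt0 y_odd.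
(* Modulo q = 2p + 1 the equation reads p^x = z^2 with z nonzero, and z^(2p) = 1 by Fermat. *)
have x_even : ~~ odd x.
  have Eq : (p%:R : 'F_(2 * p + 1)) ^+ x = z%:R ^+ 2.
    rewrite -!natrX E natrD natrM (natrX _ (2 * p + 1)) -(prednK y0).
    by rewrite self_expf_Fp_eq0 // mulr0 add0r.
  apply: (even_exp_SG q_pr p3 Eq); rewrite -exprM.
  have qE : (2 * p + 1).-1 = (2 * p)%N by lia.
  rewrite -[X in _ ^+ X]qE; apply: expf_pred_Fp => //.
  apply: contraTneq isT => z0.
  move/eqP: Eq; rewrite z0 expr0n /= expf_eq0 x0 natr_Fp_eq0 // dvdn_prime2 //.
  by move/eqP; lia.
rewrite -(even_halfK x_even) in E *.
have pq : p != (2 * p + 1)%N by lia.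
have [||n nE] := split_even_power p_pr _ q_pr _ pq (odd_gt0 ky_odd) E; [lia|lia|].
have n_odd : odd n by move: ky_odd; rewrite nE /= negbK.
case=> Em.
  have m_even : ~~ odd x./2.
    apply: (even_exp_SG q_pr p3 (a := 1)); last by rewrite expr1n.
    rewrite -natrX Em natrD natrM (natrX _ (2 * p + 1)) -(prednK y0).
    by rewrite self_expf_Fp_eq0 // mulr0 addr0.
  case: (@even_power_neq1D p x./2./2 n y) => //.
  by rewrite even_halfK.
have [n1 p3E] := power_eqDtwo_exp p_pr q_pr p3 y_odd n_odd Em.
move: nE Em E; rewrite n1 p3E => ky3 Em E.
(* [ky3] says that ky = n + 2 = 3. *)
have /orP[] : (y == 1%N) || (y == 3%N) by lia.
all: move=> /eqP y_val; rewrite y_val /= in ky3 Em E *.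
- have x4 : x./2 = 2%N.
    by apply/eqP; rewrite -(eqn_exp2l _ _ (isT : 1 < 3)%N) Em.
  have k3 : k = 3%N by lia.
  split=> //; first by rewrite x4.
  by move: E; rewrite x4 k3; nia.
(* For y = 3, 7^3 + 2 = 345 is not a power of 3, since 9 does not divide it. *)
- by case: x./2 Em => [|[|m]] //; rewrite !expnS expn0; lia.
Qed.

Theorem theorem4p4 (p k x y z : nat)
  (hp : sophie_germain_prime p) (hp4 : (p = 3 %[mod 4])%N) :
  p%:Z ^+ x - (2 ^+ k * (2 * p%:Z + 1)) ^+ y = z%:Z ^+ 2 <->
  [/\ x = 0%N, y = 0%N & z = 0%N] \/
  [/\ p = 3%N, k = 3%N, x = 4%N, y = 1%N & z = 5%N].
Proof.
have /andP[p_pr q_pr] := hp.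
split=> [E|[[-> -> ->]|[-> -> -> -> ->]]] //.
have {}E : (p ^ x = (2 ^ k * (2 * p + 1)) ^ y + z ^ 2)%N.
  have castE : ((2 ^ k * (2 * p + 1)) ^ y)%:Z = (2 ^+ k * (2 * p%:Z + 1)) ^+ y.
    by rewrite -!natz natrX natrM natrX natrD natrM.
  apply/eqP; rewrite -eqz_nat PoszD castE -!natz !natrX.
  by rewrite addrC -subr_eq !natz E.
have [x0|x_gt0] := posnP x; last by right; apply: (SG_equation_nat p_pr q_pr).
left; move: E; rewrite x0 expn0 => E.
(* For x = 0 the left side is 1, so a base above 1 forces y = 0 and then z = 0. *)
have q_gt1 : (1 < 2 ^ k * (2 * p + 1))%N.
  by have := expn_gt0 2 k; have := prime_gt1 q_pr; nia.
have [y0|y_gt0] := posnP y.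
  by split=> //; move: E; rewrite y0 expn0; nia.
have := leq_pexp2l (ltnW q_gt1) y_gt0; rewrite expn1; lia.
Qed.
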